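(* Let $n\geq 2$ and let $\mathbb{F}_n$ be the free group with free generators $x_1,\ldots,x_n$. For $1\leq i\leq n-1$ let $\eta_1(s_i)$ be the endomorphism of $\mathbb{F}_n$ given by $$x_i\mapsto x_ix_{i+1}x_i^{-1},\qquad x_{i+1}\mapsto x_ix_{i+1}^{-1}x_ix_{i+1}x_i^{-1},\qquad x_k\mapsto x_k \text{ for } k\notin\{i,i+1\}.$$ Then the assignment $s_i\mapsto \eta_1(s_i)$ defines a representation (group homomorphism) $\eta_1:T_n\rightarrow \mathrm{Aut}(\mathbb{F}_n)$ of the twin group $T_n$.
   Context: For $n\geq 2$, the twin group $T_n$ is the group with generators $s_1,\ldots,s_{n-1}$ and defining relations $s_i^2=1$ for $1\leq i\leq n-1$, and $s_is_j=s_js_i$ for $|i-j|\geq 2$. *)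

(* Defs.v *)
From HB Require Import structures.
From mathcomp Require Import all_boot.
From mathcomp Require Import boolp.

Set Implicit Arguments.
Unset Strict Implicit.
Unset Printing Implicit Defensive.

Local Open Scope group_scope.
Local Open Scope quotient_scope.

(* The letter (x, true) stands for the generator x and (x, false) for x^-1. *)
Definition word (X : choiceType) : Type := seq (X * bool).

Definition pos_letter (X : choiceType) (x : X) : X * bool := (x, true).
Definition inv_letter (X : choiceType) (l : X * bool) : X * bool := (l.1, ~~ l.2).
Definition inv_word (X : choiceType) (w : word X) : word X :=
  rev (map (@inv_letter X) w).

(* R u v is the defining relation u = v. *)
Inductive word_cong (X : choiceType) (R : word X -> word X -> Prop) :
    word X -> word X -> Prop :=
| wc_refl u : word_cong R u u
| wc_sym u v : word_cong R u v -> word_cong R v u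
| wc_trans u v w : word_cong R u v -> word_cong R v w -> word_cong R u w
| wc_cat u u' v v' :
    word_cong R u u' -> word_cong R v v' -> word_cong R (u ++ v) (u' ++ v')
| wc_cancel l : word_cong R [:: l; inv_letter l] [::]
| wc_rel u v : R u v -> word_cong R u v.

Section PresentedGroup.
Variables (X : choiceType) (R : word X -> word X -> Prop).

Definition word_congb : rel (seq (X * bool)) := fun u v => `[< word_cong R u v >].

Lemma word_congb_refl : reflexive word_congb.
Proof. by move=> u; apply/asboolP; exact: wc_refl. Qed.

Lemma word_congb_sym : symmetric word_congb.
Proof. by move=> u v; apply/asboolP/asboolP; exact: wc_sym. Qed.

Lemma word_congb_trans : transitive word_congb.
Proof. by move=> v u w /asboolP uv /asboolP vw; apply/asboolP; exact: wc_trans vw. Qed.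

Canonical word_equiv :=
  EquivRel word_congb word_congb_refl word_congb_sym word_congb_trans.

Definition presented_group := {eq_quot word_equiv}.
HB.instance Definition _ := EqQuotient.on presented_group.
HB.instance Definition _ := Choice.on presented_group.

Definition pres_class (w : word X) : presented_group := \pi_presented_group w.
Definition pres_gen (x : X) : presented_group := pres_class [:: pos_letter x].

Lemma pres_classP u v : pres_class u = pres_class v <-> word_cong R u v.
Proof.
split=> [/eqP|uv]; first by rewrite eqquotE => /asboolP.
by apply/eqP; rewrite eqquotE; apply/asboolP.
Qed.

Lemma repr_cong u : word_cong R (repr (pres_class u)) u.
Proof. by apply/pres_classP; rewrite /pres_class reprK. Qed.

Lemma inv_letterK : involutive (@inv_letter X).
Proof. by case=> x b; rewrite /inv_letter /= negbK. Qed.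

Lemma inv_wordK : involutive (@inv_word X).
Proof. by move=> w; rewrite /inv_word map_rev revK mapK //; exact: inv_letterK. Qed.

Lemma cat_inv_word w : word_cong R (w ++ inv_word w) [::].
Proof.
elim: w => [|l w IH]; first exact: wc_refl.
rewrite /inv_word /= rev_cons -cats1 -/(inv_word w) catA.
apply: wc_trans (wc_cancel R l).
apply: (@wc_cat _ _ [:: l] [:: l] _ [:: inv_letter l]); first exact: wc_refl.
by apply: (wc_cat (u' := [::]) IH); exact: wc_refl.
Qed.

Lemma inv_word_cat w : word_cong R (inv_word w ++ w) [::].
Proof. by rewrite -{2}[w]inv_wordK; exact: cat_inv_word. Qed.

Lemma inv_word_cong u v : word_cong R u v -> word_cong R (inv_word u) (inv_word v).
Proof.
move=> uv; apply: (@wc_trans _ _ _ (inv_word u ++ (v ++ inv_word v))).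
  rewrite -[X in word_cong _ X]cats0; apply: wc_cat; first exact: wc_refl.
  exact/wc_sym/cat_inv_word.
rewrite catA -[X in word_cong _ _ X]cat0s; apply: wc_cat; last exact: wc_refl.
apply: wc_trans (inv_word_cat u); apply: wc_cat; first exact: wc_refl.
exact: wc_sym.
Qed.

Definition pres_one : presented_group := pres_class [::].
Definition pres_mul (p q : presented_group) : presented_group :=
  pres_class (repr p ++ repr q).
Definition pres_inv (p : presented_group) : presented_group :=
  pres_class (inv_word (repr p)).

Lemma pres_ind (P : presented_group -> Prop) :
  (forall w, P (pres_class w)) -> forall p, P p.
Proof. by move=> Pw p; rewrite -[p]reprK; exact: Pw. Qed.

Lemma pres_mulE u v : pres_mul (pres_class u) (pres_class v) = pres_class (u ++ v).
Proof. by apply/pres_classP; apply: wc_cat; exact: repr_cong. Qed.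

Lemma pres_invE u : pres_inv (pres_class u) = pres_class (inv_word u).
Proof. by apply/pres_classP; apply: inv_word_cong; exact: repr_cong. Qed.

Lemma pres_mulA : associative pres_mul.
Proof.
by elim/pres_ind=> u; elim/pres_ind=> v; elim/pres_ind=> w; rewrite !pres_mulE catA.
Qed.

Lemma pres_1mul : left_id pres_one pres_mul.
Proof. by elim/pres_ind=> u; rewrite pres_mulE. Qed.

Lemma pres_mul1 : right_id pres_one pres_mul.
Proof. by elim/pres_ind=> u; rewrite pres_mulE cats0. Qed.

Lemma pres_Vmul : left_inverse pres_one pres_inv pres_mul.
Proof.
by elim/pres_ind=> u; rewrite pres_invE pres_mulE; apply/pres_classP/inv_word_cat.
Qed.

Lemma pres_mulV : right_inverse pres_one pres_inv pres_mul.
Proof.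
by elim/pres_ind=> u; rewrite pres_invE pres_mulE; apply/pres_classP/cat_inv_word.
Qed.

HB.instance Definition _ := isGroup.Build presented_group
  pres_mulA pres_1mul pres_mul1 pres_Vmul pres_mulV.

End PresentedGroup.

Section PresentedLift.
Variables (X : choiceType) (R : word X -> word X -> Prop).
Variables (G : groupType) (f : X -> G).

Definition word_eval (w : word X) : G :=
  \prod_(l <- w) (if l.2 then f l.1 else (f l.1)^-1).

Hypothesis fR : forall u v, R u v -> word_eval u = word_eval v.

(* The respect hypothesis, unused in the body, makes the map carry a canonical
   morphism structure. *)
Definition pres_lift of (forall u v, R u v -> word_eval u = word_eval v) :=
  fun p : presented_group R => word_eval (repr p).

Lemma word_eval_cong u v : word_cong R u v -> word_eval u = word_eval v.
Proof.
elim=> {u v} // [u v w _ -> //|u u' v v' _ IHu _ IHv|[x b]].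
  by rewrite /word_eval !big_cat; congr (_ * _).
rewrite /word_eval !big_cons !big_nil mulg1 /=.
by case: b => /=; rewrite ?mulgV ?mulVg.
Qed.

Lemma pres_liftE w : pres_lift fR (pres_class R w) = word_eval w.
Proof. by apply: word_eval_cong; exact: repr_cong. Qed.

Lemma pres_lift_gen x : pres_lift fR (pres_gen R x) = f x.
Proof. by rewrite pres_liftE /word_eval big_seq1. Qed.

Lemma pres_liftM : {morph pres_lift fR : p q / p * q}.
Proof.
elim/pres_ind=> u; elim/pres_ind=> v.
by rewrite [_ * _]pres_mulE !pres_liftE /word_eval big_cat.
Qed.

Lemma pres_lift1 : pres_lift fR 1 = 1.
Proof. by rewrite [1]/(pres_class R [::]) pres_liftE /word_eval big_nil. Qed.

HB.instance Definition _ :=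
  isMultiplicative.Build (presented_group R) G (pres_lift fR) pres_liftM.
HB.instance Definition _ :=
  Multiplicative_isUMagmaMorphism.Build (presented_group R) G (pres_lift fR) pres_lift1.

Lemma pres_lift_unique (g : {multiplicative presented_group R -> G}) :
  (forall x, g (pres_gen R x) = f x) -> g =1 pres_lift fR.
Proof.
move=> gf; have g1 : g 1 = 1 by apply: (mulgI (g 1)); rewrite -gmulfM !mulg1.
elim/pres_ind=> w; rewrite pres_liftE; elim: w => [|[x b] w IH].
  by rewrite /word_eval big_nil.
rewrite -cat1s -pres_mulE [g _]gmulfM IH /word_eval big_cons; congr (_ * _).
case: b => /=; first exact: gf.
apply: (mulgI (f x)); rewrite mulgV -gf -gmulfM [_ * _]pres_mulE -g1.
by congr (g _); apply/pres_classP; exact: (wc_cancel R (x, true)).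
Qed.

End PresentedLift.

Definition no_rel (X : choiceType) : word X -> word X -> Prop := fun _ _ => False.

Notation free_group X := (presented_group (@no_rel X)).
Notation free_gen := (pres_gen (@no_rel _)).

Lemma no_relP (X : choiceType) (G : groupType) (f : X -> G) (u v : word X) :
  no_rel u v -> word_eval f u = word_eval f v.
Proof. by case. Qed.

Definition free_lift (X : choiceType) (G : groupType) (f : X -> G) :
    {multiplicative free_group X -> G} :=
  pres_lift (@no_relP X G f).

Lemma free_lift_gen (X : choiceType) (G : groupType) (f : X -> G) (x : X) :
  free_lift f (free_gen x) = f x.
Proof. exact: pres_lift_gen. Qed.

Lemma free_lift_unique (X : choiceType) (G : groupType) (f : X -> G)
    (g : {multiplicative free_group X -> G}) :
  (forall x, g (free_gen x) = f x) -> g =1 free_lift f.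
Proof. exact: pres_lift_unique. Qed.

Section GroupAut.
Variable G : groupType.

Definition is_group_aut (f : G -> G) : bool :=
  `[< bijective f /\ {morph f : x y / x * y} >].

Record group_aut := GroupAut { aut_fun :> G -> G; aut_funP : is_group_aut aut_fun }.

HB.instance Definition _ := [isSub for aut_fun].
HB.instance Definition _ := [Choice of group_aut by <:].

Lemma aut_bij (a : group_aut) : bijective a.
Proof. by case: a => f /= /asboolP[]. Qed.

Lemma autM (a : group_aut) : {morph a : x y / x * y}.
Proof. by case: a => f /= /asboolP[]. Qed.

Lemma aut_eqP (a b : group_aut) : a =1 b -> a = b.
Proof. by move=> ab; apply/val_inj/funext. Qed.

Lemma aut_one_subproof : is_group_aut id.
Proof. by apply/asboolP; split=> //; exists id. Qed.
Definition aut_one := GroupAut aut_one_subproof.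

Lemma aut_mul_subproof (a b : group_aut) : is_group_aut (a \o b).
Proof.
apply/asboolP; split; first by apply: bij_comp; exact: aut_bij.
by move=> x y /=; rewrite !autM.
Qed.
Definition aut_mul (a b : group_aut) := GroupAut (aut_mul_subproof a b).

Lemma aut_inv_ex (a : group_aut) : exists g : G -> G, cancel a g /\ cancel g a.
Proof. by have [g ag ga] := aut_bij a; exists g. Qed.

Definition aut_invf (a : group_aut) : G -> G := sval (cid (aut_inv_ex a)).

Lemma aut_invfK (a : group_aut) : cancel a (aut_invf a).
Proof. by rewrite /aut_invf; case: cid => g []. Qed.

Lemma aut_invfVK (a : group_aut) : cancel (aut_invf a) a.
Proof. by rewrite /aut_invf; case: cid => g []. Qed.

Lemma aut_inv_subproof (a : group_aut) : is_group_aut (aut_invf a).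
Proof.
apply/asboolP; split; first by exists a; [exact: aut_invfVK|exact: aut_invfK].
by move=> x y; apply: (can_inj (aut_invfK a)); rewrite autM !aut_invfVK.
Qed.
Definition aut_inv (a : group_aut) := GroupAut (aut_inv_subproof a).

Lemma aut_mulA : associative aut_mul.
Proof. by move=> a b c; exact: aut_eqP. Qed.
Lemma aut_1mul : left_id aut_one aut_mul.
Proof. by move=> a; exact: aut_eqP. Qed.
Lemma aut_mul1 : right_id aut_one aut_mul.
Proof. by move=> a; exact: aut_eqP. Qed.
Lemma aut_Vmul : left_inverse aut_one aut_inv aut_mul.
Proof. by move=> a; apply: aut_eqP => x /=; exact: aut_invfK. Qed.
Lemma aut_mulV : right_inverse aut_one aut_inv aut_mul.
Proof. by move=> a; apply: aut_eqP => x /=; exact: aut_invfVK. Qed.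

HB.instance Definition _ :=
  isGroup.Build group_aut aut_mulA aut_1mul aut_mul1 aut_Vmul aut_mulV.

End GroupAut.

(* Indices start at 0, so the n.-1 generators are indexed by 'I_n.-1. *)
Inductive twin_rel (n : nat) : word 'I_n.-1 -> word 'I_n.-1 -> Prop :=
| twin_sq (i : 'I_n.-1) : twin_rel [:: pos_letter i; pos_letter i] [::]
| twin_comm (i j : 'I_n.-1) :
    (i.+2 <= j)%N || (j.+2 <= i)%N ->
    twin_rel [:: pos_letter i; pos_letter j] [:: pos_letter j; pos_letter i].

Notation twin_group n := (presented_group (@twin_rel n)).

Definition twin_gen (n : nat) (i : 'I_n.-1) : twin_group n := pres_gen (@twin_rel n) i.

Lemma strand_left_subproof (n : nat) (i : 'I_n.-1) : (i < n)%N.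
Proof. exact: leq_trans (ltn_ord i) (leq_pred n). Qed.
Definition strand_left (n : nat) (i : 'I_n.-1) : 'I_n :=
  Ordinal (strand_left_subproof i).

Lemma strand_right_subproof (n : nat) (i : 'I_n.-1) : (i.+1 < n)%N.
Proof. by rewrite -ltn_predRL. Qed.
Definition strand_right (n : nat) (i : 'I_n.-1) : 'I_n :=
  Ordinal (strand_right_subproof i).

Definition eta1 (n : nat) (i : 'I_n.-1) :
    {multiplicative free_group 'I_n -> free_group 'I_n} :=
  let x := free_gen (strand_left i) in
  let y := free_gen (strand_right i) in
  free_lift (fun k : 'I_n =>
    if k == strand_left i then x * y * x^-1
    else if k == strand_right i then x * y^-1 * x * y * x^-1
    else free_gen k).

Lemma eta1_left (n : nat) (i : 'I_n.-1) :
  let x := free_gen (strand_left i) in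
  let y := free_gen (strand_right i) in
  eta1 i x = x * y * x^-1.
Proof. by rewrite /= free_lift_gen eqxx. Qed.

Lemma eta1_right (n : nat) (i : 'I_n.-1) :
  let x := free_gen (strand_left i) in
  let y := free_gen (strand_right i) in
  eta1 i y = x * y^-1 * x * y * x^-1.
Proof.
by rewrite /= free_lift_gen -val_eqE /= eqxx (gtn_eqF (leqnn _)).
Qed.

Lemma eta1_other (n : nat) (i : 'I_n.-1) (k : 'I_n) :
  k != strand_left i -> k != strand_right i -> eta1 i (free_gen k) = free_gen k.
Proof. by move=> /negPf kl /negPf kr; rewrite free_lift_gen kl kr. Qed.

(* Main.v *)
Require Import Defs.
From mathcomp Require Import all_boot.
From mathcomp Require Import boolp zify.

Set Implicit Arguments.
Unset Strict Implicit.
Unset Printing Implicit Defensive.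

Local Open Scope group_scope.

(** Write [x] and [y] for the two generators moved by [s_i], and put
    [z = x * y * x^-1].  The formulas for [eta1 i] look asymmetric only because
    of the chosen basis: [y] is [z] conjugated by [x], so [x] and [z] together
    with the other generators again form a basis of the free group, and in this
    basis [eta1 i] just exchanges [x] and [z] ([eta1_left], [eta1_conj]).
    Indeed the prescribed image of [y] is [x] conjugated by [z].  Hence [eta1 i]
    is an involution ([eta1K]); in particular it is an automorphism, and the
    relation [s_i^2 = 1] holds.

    If [i] and [j] are at distance at least two, [eta1 i] and [eta1 j] move
    disjoint pairs of generators and each maps the subgroup generated by its
    pair to itself, so they commute ([eta1_comm]).

    Both kinds of defining relations of the twin group being respected, the
    universal property of the presentation yields the homomorphism, and its
    uniqueness. *)

(** Cancellation in [H] forces [f 1 = 1], so multiplicativity alone makes [f] a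
    group morphism. *)
Lemma multiplicativeV (G H : groupType) (f : {multiplicative G -> H}) :
  {morph f : x / x^-1}.
Proof.
have f1 : f 1 = 1 by apply: (mulgI (f 1)); rewrite -gmulfM !mulg1.
by move=> x; apply: (mulgI (f x)); rewrite -gmulfM !mulgV.
Qed.

Lemma free_hom_ext (X : choiceType) (G : groupType)
    (f g : {multiplicative free_group X -> G}) :
  (forall x, f (free_gen x) = g (free_gen x)) -> f =1 g.
Proof. by move=> fg p; rewrite (free_lift_unique fg) -(free_lift_unique (g := g)). Qed.

(** Together with [eta1_left], this exhibits [eta1 i] as the exchange of [x] and
    its partner [x * y * x^-1]. *)
Lemma eta1_conj n (i : 'I_n.-1) :
  let x := free_gen (strand_left i) in
  let y := free_gen (strand_right i) in
  eta1 i (x * y * x^-1) = x.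
Proof.
move=> x y; rewrite !gmulfM multiplicativeV eta1_left eta1_right -/x -/y.
by rewrite !invgM invgK !mulgA !(mulgK, mulgVK).
Qed.

Lemma eta1K n (i : 'I_n.-1) : involutive (eta1 i).
Proof.
apply: (free_hom_ext (f := eta1 i \o eta1 i) (g := idfun)) => k.
change (eta1 i (eta1 i (free_gen k)) = free_gen k).
have [->|kl] := eqVneq k (strand_left i); first by rewrite eta1_left eta1_conj.
have [->|kr] := eqVneq k (strand_right i); last by rewrite !eta1_other.
set x := free_gen (strand_left i); set y := free_gen _.
pose z := x * y * x^-1.
have xz : eta1 i x = z := eta1_left i.
have zx : eta1 i z = x := eta1_conj i.
have etaJ u v : eta1 i (v ^ u) = eta1 i v ^ eta1 i u.
  by rewrite !conjgE !gmulfM multiplicativeV.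
(* [x ^ z] is the prescribed image of [y], and the exchange turns it back
   into [z ^ x = y]. *)
have -> : y = z ^ x by rewrite conjgE !mulgA mulVg mul1g mulgVK.
by rewrite !etaJ xz zx xz.
Qed.

(** This is where the distance between [i] and [j] enters: [eta1 j] fixes
    both generators moved by [s_i], hence every word in them, and [eta1 i] sends
    these generators to such words. *)
Lemma eta1_far_fix n (i j : 'I_n.-1) (k : 'I_n) :
  (i.+2 <= j)%N || (j.+2 <= i)%N ->
  (k == strand_left i) || (k == strand_right i) ->
  eta1 j (free_gen k) = free_gen k /\
  eta1 j (eta1 i (free_gen k)) = eta1 i (free_gen k).
Proof.
move=> ij.
have lf : eta1 j (free_gen (strand_left i)) = free_gen (strand_left i).
  by apply: eta1_other; rewrite -val_eqE /=; case/orP: ij; lia.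
have rf : eta1 j (free_gen (strand_right i)) = free_gen (strand_right i).
  by apply: eta1_other; rewrite -val_eqE /=; case/orP: ij; lia.
case/orP=> /eqP->; rewrite ?eta1_left ?eta1_right;
  by rewrite !(gmulfM, multiplicativeV) ?lf ?rf.
Qed.

Lemma eta1_comm n (i j : 'I_n.-1) :
  (i.+2 <= j)%N || (j.+2 <= i)%N -> eta1 i \o eta1 j =1 eta1 j \o eta1 i.
Proof.
move=> ij; apply: free_hom_ext => k.
change (eta1 i (eta1 j (free_gen k)) = eta1 j (eta1 i (free_gen k))).
have [/(eta1_far_fix ij)[-> ->]//|ki] :=
  boolP ((k == strand_left i) || (k == strand_right i)).
rewrite orbC in ij.
have [/(eta1_far_fix ij)[-> ->]//|kj] :=
  boolP ((k == strand_left j) || (k == strand_right j)).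
move: ki kj; rewrite !negb_or => /andP[? ?] /andP[? ?].
by rewrite !eta1_other.
Qed.

Lemma eta1_is_group_aut n (i : 'I_n.-1) : is_group_aut (eta1 i).
Proof.
apply/asboolP; split; first exact: inv_bij (@eta1K n i).
exact: gmulfM.
Qed.

Definition eta1_aut n (i : 'I_n.-1) : group_aut (free_group 'I_n) :=
  GroupAut (eta1_is_group_aut i).

Lemma eta1_aut_twin_rel n (u v : word 'I_n.-1) :
  twin_rel u v -> word_eval (@eta1_aut n) u = word_eval (@eta1_aut n) v.
Proof.
case=> [i|i j ij]; rewrite /word_eval !big_cons !big_nil /= !mulg1.
  by apply: aut_eqP => p; exact: eta1K.
by apply: aut_eqP => p; exact: eta1_comm.
Qed.

Theorem proposition3 (n : nat) (n_ge2 : (2 <= n)%N) :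
  exists eta : {multiplicative twin_group n -> group_aut (free_group 'I_n)},
    (forall i : 'I_n.-1, aut_fun (eta (twin_gen i)) =1 eta1 i) /\
    (forall eta' : {multiplicative twin_group n -> group_aut (free_group 'I_n)},
       (forall i : 'I_n.-1, aut_fun (eta' (twin_gen i)) =1 eta1 i) ->
       eta' =1 eta).
Proof.
exists (pres_lift (@eta1_aut_twin_rel n)); split=> [i p|eta' eta'E].
  by rewrite /= pres_lift_gen.
by apply: pres_lift_unique => i; apply: aut_eqP; exact: eta'E.
Qed.
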